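(* Let $d\ge1$ and let $\phi:\mathbb{R}^d\to\mathbb{R}\cup\{+\infty\}$ be a superstable, lower regular pair potential with compact support which satisfies the integrability condition (I) and the differentiability condition (D) of the context and which is bounded on every set $\{x\in\mathbb{R}^d\mid|x|>r\}$, $r>0$. Then every tempered grandcanonical Gibbs measure associated with $\phi$ (with activity $z>0$) has full topological support on $\Gamma_{\mathbb{R}^d}$.
   Context: $\Gamma_{\mathbb{R}^d}$ is the space of all (nonnegative) integer-valued Radon measures on $\mathbb{R}^d$ with the vague topology and its Borel $\sigma$-field. A measure has full topological support if every non-empty open set has positive measure. $\gamma_\Lambda$ is the restriction of $\gamma$ to $\Lambda$, $\Lambda^C=\mathbb{R}^d\setminus\Lambda$, $m$ is Lebesgue measure, $z>0$ is fixed, $\pi_{z\cdot m}$ is the Poisson measure with intensity $z\cdot m$. A pair potential is a measurable $\phi:\mathbb{R}^d\to\mathbb{R}\cup\{+\infty\}$ with $\phi(x)=\phi(-x)$. For bounded $\Lambda$, the conditional energy is $E_\Lambda^\phi(\gamma):=\int_\Lambda\int_{\mathbb{R}^d}\phi(x-y)1_{\{x\ne y\}}\gamma(dx)\gamma(dy)$ if $\int_\Lambda\int_{\mathbb{R}^d}|\phi(x-y)|1_{\{x\ne y\}}\gamma(dx)\gamma(dy)<\infty$, and $E_\Lambda^\phi(\gamma):=+\infty$ otherwise. For $r\in\mathbb{Z}^d$ let $Q_r:=\{x\mid r^i-\frac12\le x^i<r^i+\frac12\}$, and $\Lambda_N:=[-N,N]^d$. Superstable: there are $A>0$, $B\ge0$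 with $E_{\Lambda_N}^\phi(\gamma_{\Lambda_N})\ge\sum_{r\in\mathbb{Z}^d}[A\gamma_{\Lambda_N}(Q_r)^2-B\gamma_{\Lambda_N}(Q_r)]$ for all $\gamma\in\Gamma_{\mathbb{R}^d}$, $N\in\mathbb{N}$. Lower regular: there is a decreasing positive function $a:\mathbb{N}\to[0,\infty)$ (with $0\in\mathbb N$) with $\sum_{r\in\mathbb{Z}^d}a(|r|_\infty)<\infty$ ($|\cdot|_\infty$ the maximum norm) such that, for any disjoint $\Lambda',\Lambda''$ which are finite unions of cubes $Q_r$ and all $\gamma\in\Gamma_{\mathbb{R}^d}$, $$\int_{\Lambda'}\int_{\Lambda''}\phi(x-y)\gamma(dx)\gamma(dy)\ge-\sum_{r',r''\in\mathbb{Z}^d}a(|r'-r''|_\infty)\gamma_{\Lambda'}(Q_{r'})\gamma_{\Lambda''}(Q_{r''}).$$ (I) $\int_{\mathbb{R}^d}|1-e^{-\phi(x)}|\,dx<\infty$. (D) $e^{-\phi}$ is weakly differentiable on $\mathbb{R}^d$, $\phi$ is weakly differentiable on $\mathbb{R}^d\setminus\{0\}$, and the weak gradient $\nabla\phi$ (a locally $m$-integrable function on $\mathbb{R}^d\setminus\{0\}$), considered as an $m$-a.e. defined function on $\mathbb{R}^d$, satisfies $\nabla\phi\in L^1(\mathbb{R}^d,e^{-\phi}dm)\cap L^2(\mathbb{R}^d,e^{-\phi}dm)$. Gibbs measures: for $\Lambda\subset\mathbb{R}^d$ open, bounded, non-empty, $Z_\Lambda^\phi(\gamma):=\int\exp(-E_\Lambda^\phi(\gamma_{\Lambda^C}+\omega_\Lambda))\,\pi_{z\cdot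 m}(d\omega)$ and, for measurable $B\subset\Gamma_{\mathbb{R}^d}$, $$\Pi_\Lambda^\phi(\gamma,B):=1_{\{Z_\Lambda^\phi<\infty\}}(\gamma)\frac1{Z_\Lambda^\phi(\gamma)}\int1_B(\gamma_{\Lambda^C}+\omega_\Lambda)\exp(-E_\Lambda^\phi(\gamma_{\Lambda^C}+\omega_\Lambda))\,\pi_{z\cdot m}(d\omega).$$ A probability measure $\mu$ is a grandcanonical Gibbs measure associated with $\phi$ if $\mu\Pi_\Lambda^\phi=\mu$ for all such $\Lambda$. It is tempered if it is supported by $\bigcup_{n=1}^\infty S_n$, $S_n:=\{\gamma\mid\forall N\in\mathbb{N}:\ \sum_{r\in\Lambda_N\cap\mathbb{Z}^d}\gamma(Q_r)^2\le n^2(2N+1)^d\}$.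
   Formalization: Superstability is required only for configurations without multiple points; for all integer-valued measures it cannot hold, since for γ=kδ_0 the energy is 0 (pairs x=y are excluded) while Ak²−Bk>0 for large k. *)

(* Defs.v *)
From HB Require Import structures.
From mathcomp Require Import all_boot all_order all_algebra.
From mathcomp Require Import all_classical all_reals all_analysis.
From mathcomp Require Import measurable_realfun.

Set Implicit Arguments.
Unset Strict Implicit.
Unset Printing Implicit Defensive.

Import Order.TTheory GRing.Theory Num.Theory.
Import numFieldNormedType.Exports.

Local Open Scope classical_set_scope.
Local Open Scope ring_scope.

HB.instance Definition _ (R : realType) (d : nat) :=
  @isMeasurable.Build (sigma_display (@open 'rV[R]_d)) 'rV[R]_d
    <<s @open 'rV[R]_d >> (@sigma_algebra0 _ setT _) (@sigma_algebraC _ _)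
    (@sigma_algebra_bigcup _ setT _).

Section borel_rV.
Variable R : realType.
Implicit Type d : nat.

Lemma open_measurable_rV d (U : set 'rV[R]_d) : open U -> measurable U.
Proof. by move=> oU; apply: (@sub_sigma_algebra _ setT (@open 'rV[R]_d)). Qed.

Lemma closed_measurable_rV d (F : set 'rV[R]_d) : closed F -> measurable F.
Proof.
move=> cF; rewrite -(setCK F); apply: measurableC; apply: open_measurable_rV.
exact: closed_openC.
Qed.

Lemma measurable_coord d (i : 'I_d) :
  measurable_fun [set: 'rV[R]_d] (fun v => v ord0 i).
Proof.
apply: (measurability _ (RGenOInfty.measurableE R)) => _ /= -[_ [r ->] <-].
rewrite setTI; apply: open_measurable_rV; apply: open_comp.
  by move=> v _; exact: coord_continuous.
by rewrite set_itvE; exact: open_gt.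
Qed.

Lemma open_bigcup_box d (U : set 'rV[R]_d) : open U ->
  U = \bigcup_(p : 'rV[rat]_d * nat)
    (if `[< ball (map_mx ratr p.1 : 'rV[R]_d) p.2.+1%:R^-1 `<=` U >]
     then ball (map_mx ratr p.1 : 'rV[R]_d) p.2.+1%:R^-1 else set0).
Proof.
move=> oU; apply/seteqP; split => [v Uv|v [p _]]; last first.
  by case: asboolP => [pU pv|//]; exact: pU.
have /nbhs_ballP[e /= e0 veU] : nbhs v U by exact: open_nbhs_nbhs.
have [n ne] : exists n : nat, n.+1%:R^-1 < e / 2.
  exists (Num.truncn (e / 2)^-1); rewrite invf_plt ?posrE ?divr_gt0 ?ltr0n//.
  by rewrite truncnS_gt.
have n0 : 0 < n.+1%:R^-1 :> R by rewrite invr_gt0.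
have q_ i : {q : rat | ball (v ord0 i) n.+1%:R^-1 (ratr q)}.
  have : v ord0 i - n.+1%:R^-1 < v ord0 i + n.+1%:R^-1.
    by rewrite ltrD2l (lt_trans _ n0)// oppr_lt0.
  move/rat_in_itvoo/cid => [q]; rewrite in_itv/= => /andP[q1 q2]; exists q.
  by rewrite /ball/= ltr_distlC q1.
pose q : 'rV[rat]_d := \row_i sval (q_ i).
have vq : ball (map_mx ratr q : 'rV[R]_d) n.+1%:R^-1 v.
  apply: ball_sym; split => // i j; rewrite !ord1 !mxE.
  exact: (svalP (q_ j)).
exists (q, n) => //=; case: asboolP => // qU; exfalso; apply: qU => w qw.
apply: veU; apply: (@le_ball _ _ _ (n.+1%:R^-1 + n.+1%:R^-1)).
  by rewrite [leRHS]splitr; apply/ltW/ltrD.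
by apply: ball_triangle qw; exact: ball_sym.
Qed.

Lemma measurable_rVP dT (T : measurableType dT) d (f : T -> 'rV[R]_d) :
  (forall i, measurable_fun setT (fun x => f x ord0 i)) ->
  measurable_fun setT f.
Proof.
move=> mf; apply: (@measurability _ _ _ _ setT f (@open 'rV[R]_d)) => //.
move=> _ [U oU <-]; rewrite setTI (open_bigcup_box oU) preimage_bigcup.
apply: countable_bigcupT_measurable; first exact: countableP.
move=> -[q n] /=; case: ifPn => _; last by rewrite preimage_set0.
have -> : f @^-1` ball (map_mx ratr q : 'rV[R]_d) n.+1%:R^-1 =
    \bigcap_(i : 'I_d) ((fun x => f x ord0 i) @^-1`
      ball (ratr (q ord0 i) : R) n.+1%:R^-1).
  apply/seteqP; split => [x [_ xq] i _|x xq] /=.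
    by have := xq ord0 i; rewrite mxE.
  by split => // i j; rewrite !ord1 mxE; exact: xq.
apply: fin_bigcap_measurable => [|i _]; first exact: finite_finset.
by rewrite -[X in measurable X]setTI; apply: mf => //; exact: measurable_ball.
Qed.

End borel_rV.

Section lebesgue_rV.
Variable R : realType.

Definition rVcons d (p : measurableTypeR R * 'rV[R]_d) : 'rV[R]_d.+1 :=
  row_mx (p.1%:M : 'rV[R]_1) p.2.

Lemma measurable_rVcons d : measurable_fun setT (@rVcons d).
Proof.
apply: measurable_rVP => i; case: (split_ordP (i : 'I_(1 + d))) => j ->.
  rewrite (_ : (fun _ => _) = fst); first exact: measurable_fst.
  apply/funext => p; transitivity ((p.1%:M : 'rV[R]_1) ord0 j).
    exact: row_mxEl.
  by rewrite mxE (ord1 j).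
rewrite (_ : (fun _ => _) = (fun v : 'rV[R]_d => v ord0 j) \o snd).
  exact: (measurableT_comp (measurable_coord j) measurable_snd).
by apply/funext => p; exact: row_mxEr.
Qed.

Definition rVuncons d (v : 'rV[R]_d.+1) : measurableTypeR R * 'rV[R]_d :=
  (v ord0 ord0, \row_j v ord0 (lift ord0 j)).

Lemma measurable_rVuncons d : measurable_fun setT (@rVuncons d).
Proof.
apply: measurable_fun_pair; first exact: measurable_coord.
apply: measurable_rVP => i; under eq_fun do rewrite mxE.
exact: measurable_coord.
Qed.

Lemma rVconsK d : cancel (@rVcons d) (@rVuncons d).
Proof.
move=> [x v]; congr pair.
  transitivity ((x%:M : 'rV[R]_1) ord0 ord0); last by rewrite mxE mulr1n.
  rewrite -(row_mxEl (x%:M : 'rV[R]_1) v ord0 ord0); congr fun_of_matrix.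
  exact/val_inj.
apply/rowP => j; rewrite mxE -(row_mxEr (x%:M : 'rV[R]_1) v ord0 j).
by congr fun_of_matrix; exact/val_inj.
Qed.

Section step.
Local Open Scope ereal_scope.
Variables (d : nat) (mu : {sigma_finite_measure set 'rV[R]_d -> \bar R}).

Definition lebesgue_step : set 'rV[R]_d.+1 -> \bar R :=
  pushforward (lebesgue_measure \x mu) (@rVcons d).

Let mpreimage A : measurable A -> measurable (@rVcons d @^-1` A).
Proof.
by move=> mA; rewrite -[X in measurable X]setTI; exact: measurable_rVcons.
Qed.

Let lebesgue_step0 : lebesgue_step set0 = 0.
Proof. by rewrite /lebesgue_step /pushforward preimage_set0 measure0. Qed.

Let lebesgue_step_ge0 A : 0 <= lebesgue_step A.
Proof. by rewrite /lebesgue_step /pushforward; exact: measure_ge0. Qed.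

Let lebesgue_step_sigma_additive : semi_sigma_additive lebesgue_step.
Proof.
move=> F mF tF mUF; rewrite /lebesgue_step /pushforward preimage_bigcup.
apply: measure_semi_sigma_additive => [n||].
- exact: mpreimage.
- apply/trivIsetP => /= i j _ _ ij; rewrite -preimage_setI.
  by move/trivIsetP : tF => /(_ _ _ _ _ ij) ->//; rewrite preimage_set0.
- by rewrite -preimage_bigcup; exact: mpreimage.
Qed.

HB.instance Definition _ := isMeasure.Build _ _ _ lebesgue_step
  lebesgue_step0 lebesgue_step_ge0 lebesgue_step_sigma_additive.

Let lebesgue_step_sigma_finite : sigma_finite setT lebesgue_step.
Proof.
have /sigma_finiteP[F [TF ndF Foo]] := sigma_finiteT (@lebesgue_measure R).
have /sigma_finiteP[G [TG ndG Goo]] := sigma_finiteT mu.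
exists (fun n => @rVuncons d @^-1` (F n `*` G n)).
  rewrite -preimage_bigcup; apply/esym/seteqP; split => // v _.
  have [n _ Fn] : (\bigcup_n F n) (rVuncons v).1 by rewrite -TF.
  have [k _ Gk] : (\bigcup_n G n) (rVuncons v).2 by rewrite -TG.
  exists (maxn n k) => //; split.
    by move: Fn; exact/subsetPset/ndF/leq_maxl.
  by move: Gk; exact/subsetPset/ndG/leq_maxr.
move=> n; have [mF Fn] := Foo n; have [mG Gn] := Goo n; split.
  rewrite -[X in measurable X]setTI; apply: measurable_rVuncons => //.
  exact: measurableX.
rewrite /lebesgue_step /pushforward -comp_preimage.
rewrite (_ : _ \o _ = id); last by apply/funext => p; exact: rVconsK.
by rewrite preimage_id product_measure1E// lte_mul_pinfty// ge0_fin_numE.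
Qed.

HB.instance Definition _ := @Measure_isSigmaFinite.Build _ _ _ lebesgue_step
  lebesgue_step_sigma_finite.

End step.

Fixpoint lebesgue_rV d : {sigma_finite_measure set 'rV[R]_d -> \bar R} :=
  match d with
  | 0 => \d_(0 : 'rV[R]_0)
  | d'.+1 => lebesgue_step (lebesgue_rV d')
  end.

End lebesgue_rV.

Lemma lebesgue_rV_box (R : realType) d (a b : 'I_d -> R) :
  (forall i, a i <= b i) ->
  lebesgue_rV R d [set v : 'rV[R]_d | forall i, v ord0 i \in `[a i, b i[] =
    (\prod_(i < d) (b i - a i))%:E.
Proof.
elim: d a b => [|d IHd] a b ab.
  rewrite big_ord0 /= diracE mem_set// => -[].
  by [].
rewrite big_ord_recl /= /lebesgue_step /pushforward.
set A := (X in product_measure1 _ _ X).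
have -> : A = `[a ord0, b ord0[%classic `*`
    [set v : 'rV[R]_d | forall i, v ord0 i \in `[a (lift ord0 i), b (lift ord0 i)[].
  rewrite /A; apply/seteqP; split => -[x v] /= => [xv|[ax xv] i].
    have E := rVconsK (x, v); split.
      by rewrite -[x](congr1 fst E); exact: xv.
    move=> i; rewrite -[v](congr1 snd E) mxE; exact: xv.
  have [j ->|->] := unliftP ord0 i.
    by have := xv j; rewrite -{1}[v](congr1 snd (rVconsK (x, v))) mxE.
  by have := ax; rewrite -{1}[x](congr1 fst (rVconsK (x, v))).
rewrite product_measure1E//=.
- rewrite lebesgue_measure_itv/= IHd// lte_fin; case: ltP => // ba.
  by rewrite (@le_anti _ _ (a ord0) (b ord0)) ?ab// subrr mul0r mul0e.
- have -> : [set v : 'rV[R]_d | forall i,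
      v ord0 i \in `[a (lift ord0 i), b (lift ord0 i)[] =
      \bigcap_i ((fun v : 'rV[R]_d => v ord0 i) @^-1`
        `[a (lift ord0 i), b (lift ord0 i)[).
    by apply/seteqP; split=> [v + i _|v + i]; apply.
  apply: fin_bigcap_measurable => [|i _]; first exact: finite_finset.
  rewrite -[X in measurable X]setTI; exact: measurable_coord.
Qed.

Section configuration.
Local Open Scope ereal_scope.
Context {R : realType} {d : nat}.
Notation V := 'rV[R]_d.

(* Every measure on the Borel sets of R^d that is finite on compact sets is
   Radon, so no regularity has to be required. *)
Record config := Config {
  config_measure :> {measure set V -> \bar R} ;
  config_compact : forall K : set V, compact K -> config_measure K < +oo ;
  config_integer : forall A : set V, measurable A ->
    config_measure A = +oo \/ exists k : nat, config_measure A = k%:R%:E }.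

Lemma config0_subproof :
  (forall K : set V, compact K -> (mzero : set V -> \bar R) K < +oo) /\
  (forall A : set V, measurable A -> (mzero : set V -> \bar R) A = +oo \/
    exists k : nat, (mzero : set V -> \bar R) A = k%:R%:E).
Proof. by split => [K _|A _]; rewrite /mzero ?ltry//; right; exists 0%N. Qed.

Definition config0 : config :=
  Config config0_subproof.1 config0_subproof.2.

HB.instance Definition _ := gen_eqMixin config.
HB.instance Definition _ := gen_choiceMixin config.
HB.instance Definition _ := isPointed.Build config config0.

Definition compactly_supported (f : V -> R) :=
  compact (closure [set x | f x != 0%R]).

(* Vague topology: the coarsest one for which gamma |-> \int f dgamma is
   continuous for every continuous compactly supported f. *)
HB.instance Definition _ := @isSubBaseTopological.Build config
  ((V -> R) * set R)%type
  [set p | [/\ continuous p.1, compactly_supported p.1 & open p.2]]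
  (fun p => [set g : config | p.2 (\int[g]_x p.1 x)%R]).

HB.instance Definition _ :=
  @isMeasurable.Build (sigma_display (@open config)) config
    <<s @open config >> (@sigma_algebra0 _ setT _) (@sigma_algebraC _ _)
    (@sigma_algebra_bigcup _ setT _).

Section restriction.
Variables (L : set V) (mL : measurable L) (g : config).

Lemma config_restr_subproof :
  (forall K : set V, compact K -> mrestr g mL K < +oo) /\
  (forall A : set V, measurable A -> mrestr g mL A = +oo \/
    exists k : nat, mrestr g mL A = k%:R%:E).
Proof.
split => [K cK|A mA]; last first.
  by apply: config_integer; exact: measurableI.
have mK : measurable K.
  by apply: closed_measurable_rV; apply: compact_closed => //; exact: norm_hausdorff.
rewrite /mrestr (le_lt_trans _ (config_compact g cK))// le_measure ?inE//.
exact: measurableI.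
Qed.

Definition measurable_restr : config :=
  Config config_restr_subproof.1 config_restr_subproof.2.

End restriction.

(* The restriction of g to L; the value for a non-measurable L is irrelevant. *)
Definition restr (g : config) (L : set V) : config :=
  if pselect (measurable L) is left mL then measurable_restr mL g else config0.

Lemma restrE (g : config) (L A : set V) : measurable L ->
  restr g L A = g (A `&` L).
Proof. by move=> mL; rewrite /restr; case: pselect. Qed.

Lemma config_add_subproof (g h : config) :
  (forall K : set V, compact K -> measure_add g h K < +oo) /\
  (forall A : set V, measurable A -> measure_add g h A = +oo \/
    exists k : nat, measure_add g h A = k%:R%:E).
Proof.
split => [K cK|A mA]; rewrite measure_addE.
  by rewrite lte_add_pinfty// config_compact.
have [->|[k ->]] := config_integer g mA.
  by left; rewrite addye// gt_eqF// (lt_le_trans _ (measure_ge0 h A)).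
have [->|[l ->]] := config_integer h mA; first by left.
by right; exists (k + l)%N; rewrite natrD.
Qed.

Definition config_add (g h : config) : config :=
  Config (config_add_subproof g h).1 (config_add_subproof g h).2.

Lemma config_addE (g h : config) (A : set V) : config_add g h A = g A + h A.
Proof. exact: measure_addE. Qed.

End configuration.
Arguments config : clear implicits.

Section differentiability.
Context {R : realType} {d : nat}.
Notation V := 'rV[R]_d.
Notation leb := (lebesgue_rV R d).
Implicit Types (U : set V) (g : V -> V).

(* The Euclidean norm; the library norm on row vectors is the maximum norm. *)
Definition enorm (x : V) : R := Num.sqrt (\sum_(i < d) x ord0 i ^+ 2).

Definition partial (i : 'I_d) (f : V -> R) (x : V) : R :=
  'D_(delta_mx ord0 i) f x.

Fixpoint Ck (k : nat) (f : V -> R) : Prop :=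
  if k is k'.+1 then
    continuous f /\ forall i : 'I_d,
      (forall x, derivable f x (delta_mx ord0 i)) /\ Ck k' (partial i f)
  else continuous f.

Definition test_function U (f : V -> R) : Prop :=
  [/\ forall k, Ck k f, compactly_supported f &
      closure [set x | f x != 0] `<=` U].

Definition locally_integrable_on U (f : V -> \bar R) : Prop :=
  forall K : set V, compact K -> K `<=` U -> leb.-integrable K f.

(* g is the weak gradient of f on U.  Local integrability makes f finite almost
   everywhere on U, so f may take the value +oo. *)
Definition weak_gradient U (f : V -> \bar R) g : Prop :=
  [/\ locally_integrable_on U f,
      forall i, locally_integrable_on U (fun x => (g x ord0 i)%:E) &
      forall i eta, test_function U eta ->
        ((\int[leb]_(x in U) (f x * (partial i eta x)%:E)) =
         - (\int[leb]_(x in U) (g x ord0 i * eta x)%:E))%E].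

End differentiability.

Section potential.
Context {R : realType} {d : nat}.
Notation V := 'rV[R]_d.
Notation Z := 'rV[int]_d.
Notation leb := (lebesgue_rV R d).
Local Open Scope ereal_scope.
Implicit Types (phi : V -> \bar R) (g : config R d) (L : set V) (r : Z).

Definition pair_potential phi : Prop :=
  [/\ measurable_fun setT phi, forall x, phi x != -oo &
      forall x, phi x = phi (- x)%R].

Definition energy phi L g : \bar R :=
  let E f := \int[g]_(y in L) \int[g]_x (if x != y then f (x - y)%R else 0) in
  if E (fun u => `|phi u|) < +oo then E phi else +oo.

Definition unit_cube r : set V := [set x : V | forall i : 'I_d,
  ((r ord0 i)%:~R - 2^-1 <= x ord0 i)%R /\
  (x ord0 i < (r ord0 i)%:~R + 2^-1)%R].

Definition centered_box (N : nat) : set V :=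
  [set x : V | forall i : 'I_d, (- N%:R <= x ord0 i <= N%:R)%R].

Definition supnorm r : nat := \max_(i < d) `|r ord0 i|%N.

Definition simple_config g : Prop := forall x : V, g [set x] <= 1.

(* Superstability is a condition on simple configurations.  Over all integer-
   valued measures it could not hold: by the indicator of x <> y in the energy,
   k copies of one point have energy 0, while A k^2 - B k is unbounded. *)
Definition superstable phi : Prop :=
  exists A B : R, [/\ (0 < A)%R, (0 <= B)%R &
    forall g N, simple_config g ->
      let gN := restr g (centered_box N) in
      (\sum_(r \in [set: Z])
        (A%:E * gN (unit_cube r) ^+ 2 - B%:E * gN (unit_cube r)))
      <= energy phi (centered_box N) gN].

Definition lower_regular phi : Prop :=
  exists a : nat -> R,
    [/\ forall k, (0 < a k)%R, forall k l, (k <= l)%N -> (a l <= a k)%R,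
        (\esum_(r in [set: Z]) (a (supnorm r))%:E) < +oo &
        forall (I' I'' : set Z) g, finite_set I' -> finite_set I'' ->
          let L' := \bigcup_(r in I') unit_cube r in
          let L'' := \bigcup_(r in I'') unit_cube r in
          L' `&` L'' = set0 ->
          - (\esum_(p in [set: Z * Z]) ((a (supnorm (p.1 - p.2)%R))%:E *
               restr g L' (unit_cube p.1) * restr g L'' (unit_cube p.2)))
          <= \int[g]_(y in L') \int[g]_(x in L'') phi (x - y)%R].

Definition condition_I phi : Prop :=
  (\int[leb]_x `|1 - expeR (- phi x)|) < +oo.

Definition condition_D phi : Prop :=
  (exists g : V -> V, weak_gradient setT (fun x => expeR (- phi x)) g) /\
  exists g : V -> V, [/\ weak_gradient (~` [set 0%R]) phi g,
    leb.-integrable setT (fun x => (enorm (g x))%:E * expeR (- phi x)) &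
    leb.-integrable setT (fun x => (enorm (g x) ^+ 2)%:E * expeR (- phi x))].

Definition compact_support phi : Prop :=
  compact (closure [set x | phi x != 0]).

Definition bounded_off_origin phi : Prop :=
  forall r : R, (0 < r)%R ->
    exists M : R, forall x : V, (r < enorm x)%R -> `|phi x| <= M%:E.

End potential.

Section gibbs.
Context {R : realType} {d : nat}.
Notation V := 'rV[R]_d.
Notation Z := 'rV[int]_d.
Notation leb := (lebesgue_rV R d).
Local Open Scope ereal_scope.
Implicit Types (phi : V -> \bar R) (g : config R d) (L : set V).
Implicit Types (P mu : probability (config R d) R).

(* Unlike the library's poisson_pmf, which is constantly 1 at rate 0, this is
   the point mass at 0 there. *)
Definition poisson_weight (rate : R) (k : nat) : R :=
  (rate ^+ k / k`!%:R * expR (- rate))%R.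

(* P is the Poisson measure with intensity nu: the numbers of points in
   disjoint bounded Borel sets are independent and Poisson distributed. *)
Definition poisson_measure (nu : set V -> \bar R) P : Prop :=
  forall (n : nat) (A : 'I_n -> set V) (k : 'I_n -> nat),
    (forall i, measurable (A i)) -> (forall i, bounded_set (A i)) ->
    trivIset setT A ->
    P [set g : config R d | forall i, g (A i) = (k i)%:R%:E] =
    (\prod_(i < n) poisson_weight (fine (nu (A i))) (k i))%:E.

Definition config_glue L g (w : config R d) : config R d :=
  config_add (restr g (~` L)) (restr w L).

Definition partition_function P phi L g : \bar R :=
  \int[P]_w expeR (- energy phi L (config_glue L g w)).

Definition gibbs_kernel P phi L g (B : set (config R d)) : \bar R :=
  if partition_function P phi L g < +oo then
    (partition_function P phi L g)^-1 *
    \int[P]_w ((\1_B (config_glue L g w))%:E * expeR (- energy phi L (config_glue L g w)))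
  else 0.

Definition gibbs_measure P phi mu : Prop :=
  forall L, open L -> bounded_set L -> L !=set0 ->
  forall B : set (config R d), measurable B ->
    (\int[mu]_g gibbs_kernel P phi L g B) = mu B.

Definition tempered_class (n : nat) : set (config R d) :=
  [set g : config R d | forall N : nat,
    (\esum_(r in [set r : Z | centered_box N (map_mx intr r : V)])
      g (unit_cube r) ^+ 2) <= (n%:R ^+ 2 * (2 * N + 1)%:R ^+ d)%:E].

Definition tempered mu : Prop :=
  mu (\bigcup_(n in [set n : nat | (0 < n)%N]) tempered_class n) = 1.

Definition full_topological_support mu : Prop :=
  forall U : set (config R d), open U -> U !=set0 -> 0 < mu U.

End gibbs.

(* Main.v *)
From HB Require Import structures.
Require Import Defs.
From mathcomp Require Import all_boot all_order all_algebra finmap.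
From mathcomp Require Import all_classical all_reals all_analysis.
From mathcomp Require Import measurable_realfun lra.

Set Implicit Arguments.
Unset Strict Implicit.
Unset Printing Implicit Defensive.

Import Order.TTheory GRing.Theory Num.Theory.
Import numFieldNormedType.Exports.

Local Open Scope classical_set_scope.
Local Open Scope ring_scope.

(** Conditionally on the configuration outside a bounded open set L, a Gibbs
    measure has inside L the density expeR (- energy phi L .) / Z with respect
    to a Poisson measure.  Two facts make this density positive everywhere,
    for almost every boundary condition.

    - The energy of a bounded region is never +oo: only finitely many pairs of
      points interact, and phi is finite away from the origin.  Instead of
      listing the points of a configuration, [config_integral_lty] uses that a
      locally finite integer-valued measure gives mass 0 to {h >= n} for n
      large, as soon as h is finite: these sets decrease to the empty set and
      their masses are integers.  Applied to the inner, then to the outer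
      integral, it gives [interaction_abs_lty].
    - The partition function Z is finite almost surely on the boundary
      condition, since otherwise the kernel would vanish there and mu would
      not have total mass 1.

    It remains to see that the Poisson measure charges a vague neighbourhood
    B, given by finitely many compactly supported functions, of any
    configuration g0.  Cut a large cube into cells of side 1/(m+1).  By uniform
    continuity, for m large all configurations with as many points as g0 in
    each cell lie in B ([near_cell_counts_integral]), and the event that all
    these numbers of points are prescribed has positive Poisson probability
    because every cell has positive volume ([poisson_counts_gt0]).

    Concluding requires that all the functions of configurations that occur are
    measurable for the Borel sets of the vague topology.  This is reduced to
    the measurability of g |-> g A ([measurable_config_eval]) by the theory of
    kernels ([measurable_integral_config]). *)

(** * Vague topology and compactly supported functions *)

Section configurations.
Context {R : realType} {d : nat}.
Notation V := 'rV[R]_d.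
Implicit Types (g : config R d) (f : V -> R).

Lemma measurable_continuous_rV f : continuous f -> measurable_fun setT f.
Proof.
move=> cf; apply: (measurability _ (RGenOInfty.measurableE R)).
move=> _ /= -[_ [r ->] <-].
rewrite setTI; apply: open_measurable_rV; exact: open_comp.
Qed.

Lemma subset_cball_bounded (A : set V) M :
  A `<=` [set x : V | `|x| <= M] -> bounded_set A.
Proof.
move=> AM; exists M; split; first exact: num_real.
by move=> N MN x /AM /= /le_trans; apply; exact: ltW.
Qed.

Lemma compact_cball {M : R} : compact [set x : V | `|x| <= M].
Proof.
apply: bounded_closed_compact.
  exact: (@subset_cball_bounded _ M).
apply: (@closed_comp _ _ (fun x : V => `|x|) [set y : R | y <= M]).
  by move=> x _; exact: norm_continuous.
exact: closed_le.
Qed.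

Lemma closed_cball {M : R} : closed [set x : V | `|x| <= M].
Proof.
by apply: compact_closed; [exact: norm_hausdorff|exact: compact_cball].
Qed.

Lemma bounded_subset_cball (A : set V) : bounded_set A ->
  exists M, A `<=` [set x : V | `|x| <= M].
Proof. by move=> [M [Mr AM]]; exists (M + 1); apply: AM; rewrite ltrDl. Qed.

Lemma config_bounded_fin g (A : set V) :
  measurable A -> bounded_set A -> (g A < +oo)%E.
Proof.
move=> mA /bounded_subset_cball[M AM].
rewrite (le_lt_trans _ (config_compact g (@compact_cball M)))//.
apply: le_measure => //; rewrite inE//.
by apply: closed_measurable_rV; exact: closed_cball.
Qed.

Lemma compactly_supported_bounded f : continuous f -> compactly_supported f ->
  exists2 M : R, 0 <= M & forall x, `|f x| <= M.
Proof.
move=> cf sf.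
have : compact (f @` closure [set x | f x != 0]).
  by apply: continuous_compact => //; apply: continuous_subspaceT.
move/(@compact_bounded R R^o)=> [M [Mr fM]]; exists (`|M| + 1) => [|x].
  by rewrite addr_ge0.
have [->|fx] := eqVneq (f x) 0; first by rewrite normr0 addr_ge0.
apply: (fM (`|M| + 1)); first by rewrite (le_lt_trans (ler_norm _))// ltrDl.
by exists x => //; exact: subset_closure.
Qed.

Lemma Cc_integrable g f : continuous f -> compactly_supported f ->
  g.-integrable setT (EFin \o f).
Proof.
move=> cf sf; have [M M0 fM] := compactly_supported_bounded cf sf.
have mf : measurable_fun setT (EFin \o f).
  by apply/measurable_EFinP; exact: measurable_continuous_rV.
apply/integrableP; split => //.
set K := closure [set x | f x != 0].
have mK : measurable K by apply: closed_measurable_rV; exact: closed_closure.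
have -> : (\int[g]_x `|(EFin \o f) x|)%E = (\int[g]_(x in K) `|f x|%:E)%E.
  rewrite [RHS]integral_mkcond; apply: eq_integral => x _.
  rewrite patchE; case: ifPn => // /negP/=; rewrite inE => xK.
  have [->|fx] := eqVneq (f x) 0; first by rewrite normr0.
  by exfalso; apply/xK/subset_closure.
apply: (@le_lt_trans _ _ (\int[g]_(x in K) (cst M%:E) x)%E).
  apply: ge0_le_integral => //.
  - apply/measurable_EFinP/measurableT_comp => //.
    by apply: measurable_funTS; exact: measurable_continuous_rV.
  - by move=> x Kx /=; rewrite lee_fin.
by rewrite integral_cst// lte_mul_pinfty// config_compact.
Qed.

Lemma open_vague f (U : set R) : continuous f -> compactly_supported f ->
  open U -> open [set g : config R d | U (\int[g]_x f x)].
Proof.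
move=> cf sf oU.
exists [set [set g : config R d | U (\int[g]_x f x)]];
  last by rewrite bigcup_set1.
move=> _ ->; exists [fset (f, U)]%fset.
  by move=> _ /fset1P ->; rewrite inE.
by rewrite set_fset1 bigcap_set1.
Qed.

(** The form in which neighbourhoods are used: membership in a finite
    intersection of subbasic sets is a measurable condition on parameters,
    which is not clear for an arbitrary vaguely open set. *)
Lemma vague_nbhs (U : set (config R d)) g : open U -> U g ->
  exists (n : nat) (F : 'I_n -> V -> R) (O : 'I_n -> set R),
  [/\ forall i, [/\ continuous (F i), compactly_supported (F i) & open (O i)],
      forall i, O i (\int[g]_x F i x) &
      [set h : config R d | forall i, O i (\int[h]_x F i x)] `<=` U].
Proof.
move=> [J JS <-] [B JB Bg].
have [D DS DB] := JS B JB.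
exists #|` D|, (fun i => (nth point D i).1), (fun i => (nth point D i).2).
have DE i : (i < #|` D|)%N -> nth point D i \in D by move=> iD; rewrite mem_nth.
split.
- by move=> i; have /DS := DE _ (ltn_ord i); rewrite inE.
- by move=> i; move: Bg; rewrite -DB => /(_ _ (DE _ (ltn_ord i))).
- move=> h hO; suff : B h by move=> Bh; exists B.
  rewrite -DB => p pD; move: (pD) => /=; rewrite -index_mem => ip.
  by have := hO (Ordinal ip); rewrite /= nth_index.
Qed.

Lemma measurable_Rintegral_Cc f : continuous f -> compactly_supported f ->
  measurable_fun [set: config R d] (fun g => \int[g]_x f x).
Proof.
move=> cf sf; apply: (measurability _ (RGenOInfty.measurableE R)).
move=> _ /= -[_ [r ->] <-].
rewrite setTI; apply: (@sub_sigma_algebra _ setT (@open (config R d))).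
by apply: open_vague => //; rewrite set_itvE; exact: open_gt.
Qed.

End configurations.

(** * Measurability of the number of points in a Borel set *)

Section evaluations.
Context {R : realType} {d : nat}.
Notation V := 'rV[R]_d.
Implicit Types (g : config R d) (f : V -> R).

Lemma continuous_cst (T : topologicalType) (a : T) :
  continuous (fun _ : V => a).
Proof. by move=> x; apply: cvg_cst; exact: nbhs_filter. Qed.

Definition bump (f : V -> R) : Prop :=
  [/\ continuous f, compactly_supported f & forall x, 0 <= f x].

Lemma compactly_supported_sub f1 f2 :
  (forall x, f2 x = 0 -> f1 x = 0) -> compactly_supported f2 ->
  compactly_supported f1.
Proof.
move=> f12 sf2; apply: (subclosed_compact _ sf2); first exact: closed_closure.
by apply: closure_subset => x /=; apply: contra_neq; exact: f12.
Qed.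

(** The measure of {f > 0} is the increasing limit of the integrals of
    min 1 (n f), each of which is vaguely continuous in the configuration. *)
Lemma measurable_config_bump f : bump f ->
  measurable_fun [set: config R d] (fun g => g [set x | 0 < f x]).
Proof.
move=> [cf sf f0].
pose h n x := Num.min 1 (n%:R * f x).
have h0 n x : 0 <= h n x by rewrite le_min ler01 mulr_ge0.
have ch n : continuous (h n).
  move=> x; apply: (@continuous_min R V (cst 1) (fun x => n%:R * f x)).
    exact: continuous_cst.
  by apply: cvgM (cf x); exact: continuous_cst.
have sh n : compactly_supported (h n).
  apply: compactly_supported_sub sf => x fx.
  by rewrite /h fx mulr0; apply/min_idPr.
have mO : measurable [set x | 0 < f x].
  apply: open_measurable_rV; exact: (@open_comp V R f [set y | 0 < y]).
apply: (@emeasurable_fun_cvg _ _ _ _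
    (fun n g => (\int[g]_x h n x)%:E)) => [n|g _].
  by apply/measurable_EFinP; exact: measurable_Rintegral_Cc.
have -> : (fun n => (\int[g]_x h n x)%:E) = (fun n => \int[g]_x (h n x)%:E)%E.
  apply/funext => n; rewrite /Rintegral fineK//.
  exact/integrable_fin_num/Cc_integrable.
have -> : (g [set x | (0 < f x)%R] =
    \int[g]_x (fun x => limn (fun n => (h n x)%:E)) x)%E.
  rewrite -[X in g X]setIT -(@integral_indic _ _ _ g setT)//.
  apply: eq_integral => x _; apply/esym/cvg_lim => //.
  rewrite indicE; have [fx|fx] := ltP 0 (f x).
    rewrite mem_set//; apply: cvg_near_cst.
    near=> n; congr EFin; apply/min_idPl; rewrite -ler_pdivrMr// div1r.
    by near: n; exact: nbhs_infty_ger.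
  rewrite memNset/=; last by apply/negP; rewrite -leNgt.
  apply: cvg_near_cst; near=> n; rewrite /h.
  have -> : f x = 0 by apply/eqP; rewrite eq_le fx f0.
  by rewrite mulr0; congr EFin; apply/min_idPr.
apply: cvg_monotone_convergence => //.
- by move=> n; apply/measurable_EFinP; exact: measurable_continuous_rV.
- by move=> n x _; rewrite lee_fin.
- move=> x _ m n mn; rewrite lee_fin le_min ge_min lexx/= ge_min.
  by rewrite ler_wpM2r ?orbT// ler_nat.
Unshelve. all: by end_near. Qed.

Lemma bump_ball (x : V) (r : R) :
  exists2 f, bump f & ball x r = [set y | 0 < f y].
Proof.
exists (fun y => Num.max 0 (r - `|x - y|)); last first.
  by apply/seteqP; split=> y; rewrite -ball_normE /= lt_max ltxx/= subr_gt0.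
split => [y||y]; last by rewrite le_max lexx.
- apply: (@continuous_max R V (cst 0) (fun y => r - `|x - y|)).
    exact: continuous_cst.
  have cB : continuous (fun z : V => x - z).
    move=> z; apply: cvgB; [exact: nbhs_filter| |exact: cvg_id].
    exact: continuous_cst.
  apply: cvgB; [exact: nbhs_filter|exact: continuous_cst|].
  by apply: cvg_norm (cB y); exact: nbhs_filter.
- apply: subclosed_compact (@compact_cball R d (`|x| + r)) _.
    exact: closed_closure.
  rewrite [X in _ `<=` X]((closure_id _).1 closed_cball).
  apply: closure_subset => y /=; have [//|xy _] := leP (r - `|x - y|) 0.
    by rewrite eqxx.
  rewrite -[y](subKr x) (le_trans (ler_normB _ _))// lerD2l.
  by rewrite subr_gt0 in xy; exact: ltW.
Qed.

(** A pi-system of bounded open sets, stable under intersection because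
    {f > 0} and {h > 0} meet in {f h > 0}; the sets {f > 0} avoid any
    appeal to the distance to a closed set. *)
Definition bump_supports : set (set V) :=
  [set [set x | 0 < f x] | f in bump].

Lemma bump_supportsI : setI_closed bump_supports.
Proof.
move=> _ _ [f1 [cf1 sf1 f10] <-] [f2 [cf2 sf2 f20] <-].
exists (fun x => f1 x * f2 x); last first.
  apply/seteqP; split=> x /=.
    rewrite lt_neqAle eq_sym mulf_eq0 negb_or => /andP[/andP[f1x f2x] _].
    by rewrite !lt_neqAle !(eq_sym 0) f1x f2x f10 f20.
  by move=> [f1x f2x]; rewrite mulr_gt0.
split=> [x||x]; last by rewrite mulr_ge0.
  exact: continuousM (cf1 x) (cf2 x).
by apply: compactly_supported_sub sf1 => x ->; rewrite mul0r.
Qed.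

(** Open sets are countable unions of balls with rational centres, and balls
    are supports of bumps. *)
Lemma measurable_bump_supports : measurable `<=` <<s bump_supports >>.
Proof.
apply: smallest_sub; first exact: smallest_sigma_algebra.
move=> U oU; rewrite (open_bigcup_box oU).
apply: (@countable_bigcupT_measurable _ (g_sigma_algebraType bump_supports)).
  exact: countableP.
move=> p; case: ifPn => _; last exact: measurable0.
apply: sub_sigma_algebra.
by have [f bf ->] := bump_ball (map_mx ratr p.1 : V) p.2.+1%:R^-1; exists f.
Qed.

Lemma bigcup_ball0 : \bigcup_n (ball (0 : V) n%:R) = setT.
Proof.
apply/seteqP; split=> // x _; exists (Num.truncn `|x|).+1 => //.
by rewrite -ball_normE/= sub0r normrN truncnS_gt.
Qed.

Lemma subset_ball0 (m n : nat) : (m <= n)%N ->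
  ball (0 : V) m%:R `<=` ball (0 : V) n%:R.
Proof. by move=> mn; apply: le_ball; rewrite ler_nat. Qed.

Lemma measurable_ball_rV (x : V) (r : R) : measurable (ball x r).
Proof. by apply: open_measurable_rV; exact: ball_open. Qed.

Lemma bounded_ball (x : V) (r : R) : bounded_set (ball x r).
Proof.
apply: (@subset_cball_bounded _ _ _ (`|x| + r)) => y.
rewrite -ball_normE /= => xy.
by rewrite -[y](subKr x) (le_trans (ler_normB _ _))// lerD2l ltW.
Qed.

(** Sierpinski-Dynkin on each ball, where configurations are finite and
    complements are therefore allowed; then the balls exhaust the space. *)
Lemma measurable_config_eval (A : set V) : measurable A ->
  measurable_fun [set: config R d] (fun g => g A).
Proof.
move=> mA; pose B n := ball (0 : V) n%:R.
have mB n : measurable (B n) by exact: measurable_ball_rV.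
apply: (@emeasurable_fun_cvg _ _ _ _ (fun n g => g (A `&` B n))) => [n|g _];
  last first.
  rewrite -[A in X in _ --> X]setIT -bigcup_ball0 setI_bigcupr.
  apply: nondecreasing_cvg_mu => [n||m n mn].
  - exact: measurableI.
  - by apply: bigcupT_measurable => n; exact: measurableI.
  - by apply/subsetPset; apply: setIS; exact: subset_ball0.
pose H := [set A : set V | measurable A /\
  measurable_fun [set: config R d] (fun g => g (A `&` B n))].
suff [] : H A by [].
have {mA} := measurable_bump_supports mA.
apply: (lambda_system_subset bump_supportsI) => // [|C [f bf <-]]; last first.
  have mf : measurable [set x | 0 < f x].
    apply: open_measurable_rV; apply: (@open_comp V R f [set y | 0 < y]).
      by move=> x _; case: bf => + _ _; exact.
    exact: open_gt.
  split=> //.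
  rewrite /B; have [h bh ->] := bump_ball (0 : V) n%:R.
  have [k bk <-] : bump_supports ([set x | 0 < f x] `&` [set x | 0 < h x]).
    by apply: bump_supportsI; [exists f|exists h].
  exact: measurable_config_bump.
split=> //.
- split=> //; rewrite setTI /B.
  by have [h bh ->] := bump_ball (0 : V) n%:R; exact: measurable_config_bump.
- move=> C D DC [mC HC] [mD HD]; split; first exact: measurableD.
  suff -> : (fun g : config R d => g ((C `\` D) `&` B n)) =
      (fun g => g (C `&` B n) - g (D `&` B n))%E by exact: emeasurable_funB.
  apply/funext => g; have -> : (C `\` D) `&` B n = (C `&` B n) `\` (D `&` B n).
    by apply/seteqP; split => x /=; tauto.
  rewrite measureD; [|exact: measurableI|exact: measurableI|].
    congr (_ - g _)%E; apply/seteqP; split => x [] // Dx Bx.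
    by split=> //; split=> //; exact: DC.
  apply: config_bounded_fin; first exact: measurableI.
  by apply: sub_boundedr (bounded_ball 0 n%:R) => P PB x [_]; exact: PB.
- move=> F ndF HF; split; first by apply: bigcupT_measurable => k; case: (HF k).
  apply: (@emeasurable_fun_cvg _ _ _ _ (fun k g => g (F k `&` B n))) => [k|g _].
    by case: (HF k).
  rewrite setI_bigcupl; apply: nondecreasing_cvg_mu => [k||k l kl].
  - by apply: measurableI => //; case: (HF k).
  - apply: bigcupT_measurable => k.
    by apply: measurableI => //; case: (HF k).
  - by apply/subsetPset; apply: setSI; exact/subsetPset/ndF.
Qed.

End evaluations.

(** * Integrals against configurations depending measurably on a parameter *)

Section random_configurations.
Context {R : realType} {d : nat}.
Notation V := 'rV[R]_d.
Context {dT : measure_display} {T : measurableType dT}.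
Import HBNNSimple.
Implicit Types (K : T -> config R d) (F : T * V -> \bar R).
Local Open Scope ereal_scope.

(** Equivalently, K is a kernel with values in configurations. *)
Definition random_config K : Prop :=
  forall A, measurable A -> measurable_fun setT (fun t => K t A).

(** The mass of a ball is finite for each t, but not uniformly in t, so K need
    not be a finite kernel; finiteness for each t is enough for the monotone
    class argument on one ball, and the balls exhaust the space. *)
Lemma measurable_xsection_config K (A : set (T * V)) : random_config K ->
  measurable A -> measurable_fun setT (fun t => K t (xsection A t)).
Proof.
move=> mK mA.
pose k : R.-ker T ~> V := HB.pack (fun t => config_measure (K t))
  (isKernel.Build _ _ T V R (fun t => config_measure (K t)) mK).
pose B n := ball (0%R : V) n%:R%R.
have mB n : measurable (B n) by exact: measurable_ball_rV.
apply: (@emeasurable_fun_cvg _ _ _ _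
    (fun n t => K t (xsection A t `&` B n))) => [n|t _]; last first.
  rewrite -[xsection A t in X in _ --> X]setIT -bigcup_ball0 setI_bigcupr.
  have mAB n : measurable (xsection A t `&` B n).
    by apply: measurableI => //; exact: measurable_xsection.
  apply: nondecreasing_cvg_mu => [//||m n mn]; first exact: bigcupT_measurable.
  by apply/subsetPset; apply: setIS; exact: subset_ball0.
have bK t : exists M, forall C, measurable C -> mrestr (k t) (mB n) C < M%:E.
  exists (fine (K t (B n)) + 1)%R => C mC.
  have KB : K t (B n) < +oo.
    by apply: config_bounded_fin => //; exact: bounded_ball.
  rewrite EFinD fineK ?ge0_fin_numE//.
  rewrite (@le_lt_trans _ _ (K t (B n)))//; last by rewrite lteDl ?ge0_fin_numE.
  rewrite /mrestr/=; apply: le_measure; rewrite ?inE//; exact: measurableI.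
by have [] := measurable_prod_subset_xsection_kernel bK mA.
Qed.

Lemma ge0_measurable_integral_config K F : random_config K ->
  measurable_fun setT F -> (forall z, 0 <= F z) ->
  measurable_fun setT (fun t => \int[K t]_y F (t, y)).
Proof.
move=> mK mF F0; pose F_ := nnsfun_approx measurableT mF.
apply: (@measurable_fun_xsection_integral _ _ _ _ _ F K F_).
- by move=> a b ab; exact/nd_nnsfun_approx.
- by move=> z; exact/cvg_nnsfun_approx.
- by move=> n r; apply: measurable_xsection_config.
Qed.

Lemma measurable_integral_config K F : random_config K ->
  measurable_fun setT F ->
  measurable_fun setT (fun t => \int[K t]_y F (t, y)).
Proof.
move=> mK mF; under eq_fun do rewrite integralE.
apply: emeasurable_funB.
- rewrite [X in measurable_fun _ X](_ : _ = (fun t => \int[K t]_y F^\+ (t, y))).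
    by apply: ge0_measurable_integral_config => //; exact: measurable_funepos.
  by apply/funext => t; apply: eq_integral => y _; rewrite !funeposE.
- rewrite [X in measurable_fun _ X](_ : _ = (fun t => \int[K t]_y F^\- (t, y))).
    by apply: ge0_measurable_integral_config => //; exact: measurable_funeneg.
  by apply/funext => t; apply: eq_integral => y _; rewrite !funenegE.
Qed.

End random_configurations.

(** * Interaction energy: measurability, and integrals of finite functions *)

Section energy.
Context {R : realType} {d : nat}.
Notation V := 'rV[R]_d.
Implicit Types (g : config R d) (phi : V -> \bar R) (L : set V).
Local Open Scope ereal_scope.

Definition off_origin phi (u : V) : \bar R := if u != 0%R then phi u else 0.

Lemma off_originE phi (x y : V) :
  (if x != y then phi (x - y)%R else 0) = off_origin phi (x - y)%R.
Proof. by rewrite /off_origin subr_eq0. Qed.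

(** The iterated integral of the conditional energy, without the convention
    that it is +oo when the integral of the absolute value diverges. *)
Definition interaction phi L g : \bar R :=
  \int[g]_(y in L) \int[g]_x off_origin phi (x - y)%R.

Lemma measurable_off_origin phi : measurable_fun setT phi ->
  measurable_fun setT (off_origin phi).
Proof.
move=> mphi; have -> : off_origin phi = phi \_ (~` [set 0%R]).
  apply/funext => u; rewrite /off_origin patchE in_setC.
  by rewrite (_ : (u \in [set 0%R]) = (u == 0%R))//; apply/idP/eqP; rewrite inE.
apply/(measurable_restrictT _ _).1; last exact: measurable_funTS.
apply: measurableC; apply: closed_measurable_rV; apply: compact_closed.
  exact: norm_hausdorff.
exact: compact_set1.
Qed.

Lemma measurable_rVB dT (T : measurableType dT) (f h : T -> V) :
  measurable_fun setT f -> measurable_fun setT h ->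
  measurable_fun setT (fun t => f t - h t)%R.
Proof.
move=> mf mh; apply: measurable_rVP => i.
have -> : (fun t => (f t - h t)%R ord0 i) =
    (fun t => f t ord0 i - h t ord0 i)%R.
  by apply/funext => t; rewrite !mxE.
by apply: measurable_funB; exact: (measurableT_comp (measurable_coord i)).
Qed.

(** The inner integral is measurable in (t, y), with y a parameter like t;
    the outer integral then falls under the same result. *)
Lemma measurable_interaction dT (T : measurableType dT) (K : T -> config R d)
    phi L : random_config K -> measurable_fun setT phi -> measurable L ->
  measurable_fun setT (fun t => interaction phi L (K t)).
Proof.
move=> mK mphi mL; rewrite /interaction.
pose F (p : T * V) := \int[K p.1]_x off_origin phi (x - p.2)%R.
have mF : measurable_fun setT F.
  apply: (measurable_integral_config (K := fun p : T * V => K p.1)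
    (F := fun q : (T * V) * V => off_origin phi (q.2 - q.1.2)%R)).
    by move=> A mA; exact: (measurableT_comp (mK A mA) measurable_fst).
  apply: (measurableT_comp (measurable_off_origin mphi)).
  apply: measurable_rVB; first exact: measurable_snd.
  exact: (measurableT_comp measurable_snd measurable_fst).
rewrite [X in measurable_fun _ X](_ : _ =
    (fun t => \int[K t]_y (F \_ (setT `*` L)) (t, y))).
  apply: measurable_integral_config => //.
  apply/(measurable_restrictT _ _).1; first exact: measurableX.
  exact: measurable_funTS.
apply/funext => t; rewrite integral_mkcond; apply: eq_integral => y _.
by rewrite !patchE in_setX in_setT.
Qed.

Lemma lt1_config_eq0 g (A : set V) : measurable A -> g A < 1 -> g A = 0.
Proof.
move=> mA; have [->//|[[->//|k] ->]] := config_integer g mA.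
by rewrite lte_fin ltrn1.
Qed.

(** The sets D `&` {h >= n} decrease to the empty set, so their masses, being
    integers, are eventually 0, and h is essentially bounded on D. *)
Lemma config_integral_lty g (D : set V) (h : V -> \bar R) :
  measurable D -> g D < +oo -> measurable_fun setT h ->
  (forall x, 0 <= h x) -> (forall x, h x < +oo) -> \int[g]_(x in D) h x < +oo.
Proof.
move=> mD gD mh h0 hoo.
pose A n := D `&` [set x | n%:R%:E <= h x].
have mA n : measurable (A n).
  apply: measurableI => //; rewrite -[X in measurable X]setTI.
  exact: emeasurable_fun_c_infty.
have A0 : \bigcap_n A n = set0.
  rewrite -subset0 => x Ax; have := hoo x.
  have hx : h x \is a fin_num by rewrite ge0_fin_numE.
  have [_ /=] := Ax (Num.truncn (fine (h x))).+1 I.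
  by rewrite -[h x]fineK// lee_fin leNgt truncnS_gt.
have gA : g \o A @ \oo --> 0.
  rewrite -(measure0 g) -A0; apply: nonincreasing_cvg_mu => //.
  - by rewrite (le_lt_trans _ gD)//; apply: le_measure; rewrite ?inE// => x [].
  - exact: bigcap_measurable.
  - move=> m n mn; apply/subsetPset => x [Dx nx]; split => //.
    by apply: le_trans nx; rewrite lee_fin ler_nat.
have [n An0] : exists n, g (A n) = 0.
  have : nbhs (0 : \bar R) [set x | x < 1].
    by apply: open_nbhs_nbhs; split; [exact: open_ereal_lt_ereal|exact: lte01].
  by move=> /gA[n _ /(_ n (leqnn n))] ?; exists n; exact: lt1_config_eq0.
rewrite (@ge0_negligible_integral _ _ _ g D (A n))//;
  last exact: measurable_funTS.
apply: (@le_lt_trans _ _ (\int[g]_(x in D `\` A n) (cst n%:R%:E) x)).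
  apply: ge0_le_integral => //.
  - exact: measurableD.
  - exact: measurable_funTS.
  - move=> x [Dx Ax] /=; apply/ltW; rewrite ltNge; apply/negP => nx.
    by apply: Ax.
rewrite integral_cst//; last exact: measurableD.
rewrite lte_mul_pinfty// (le_lt_trans _ gD)//.
by apply: le_measure; rewrite ?inE//; exact: measurableD.
Qed.

End energy.

(** * Finiteness of the energy, and gluing of configurations *)

Section finite_energy.
Context {R : realType} {d : nat}.
Notation V := 'rV[R]_d.
Implicit Types (g : config R d) (phi : V -> \bar R) (L : set V).
Local Open Scope ereal_scope.

Lemma bounded_off_origin_lty phi : bounded_off_origin phi ->
  forall x, x != 0%R -> `|phi x| < +oo.
Proof.
move=> phiM x x0.
have ex : (0 < enorm x)%R.
  rewrite lt_neqAle sqrtr_ge0 andbT eq_sym; apply: contra_neq x0.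
  move/eqP; rewrite sqrtr_eq0 => ex0; apply/rowP => i; rewrite mxE.
  have s0 (j : 'I_d) : (0 <= x ord0 j ^+ 2)%R by exact: sqr_ge0.
  have /eqP : (\sum_(j < d) x ord0 j ^+ 2 == 0)%R.
    by rewrite eq_le ex0 sumr_ge0.
  by move/psumr_eq0P => /(_ (fun j _ => s0 j) i isT)/eqP;
    rewrite sqrf_eq0 => /eqP.
have [|M /(_ x) xM] := phiM (enorm x / 2)%R; first by rewrite divr_gt0.
rewrite (le_lt_trans (xM _)) ?ltry//.
by rewrite ltr_pdivrMr// ltr_pMr// ltr1n.
Qed.

Lemma measurable_interaction_inner phi g : measurable_fun setT phi ->
  measurable_fun setT (fun y : V => \int[g]_x off_origin phi (x - y)%R).
Proof.
move=> mphi; apply: (measurable_integral_config (K := fun=> g)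
    (F := fun p : V * V => off_origin phi (p.2 - p.1)%R)).
  by move=> A mA; exact: measurable_cst.
apply: (measurableT_comp (measurable_off_origin mphi)).
by apply: measurable_rVB; [exact: measurable_snd|exact: measurable_fst].
Qed.

(** For y fixed, x only contributes at bounded distance from y, and the
    contribution of each x <> y is finite: the inner integral is finite for
    every y.  It may be unbounded in y, which is why the integrality of the
    configuration is used a second time. *)
Lemma interaction_abs_lty phi L g : measurable_fun setT phi ->
  compact_support phi -> (forall x, x != 0%R -> `|phi x| < +oo) ->
  measurable L -> bounded_set L ->
  interaction (fun u => `|phi u|) L g < +oo.
Proof.
move=> mphi sphi phioo mL bL.
have mabs : measurable_fun setT (fun u => `|phi u|).
  exact: measurableT_comp.
have moff := measurable_off_origin mabs.
have off0 (u : V) : 0 <= off_origin (fun u => `|phi u|) u.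
  by rewrite /off_origin; case: ifP.
have offoo (u : V) : off_origin (fun u => `|phi u|) u < +oo.
  by rewrite /off_origin; case: ifPn => // /phioo.
apply: config_integral_lty => //.
- exact: config_bounded_fin.
- exact: measurable_interaction_inner.
- by move=> y; exact: integral_ge0.
move=> y; have [M KM] := bounded_subset_cball (compact_bounded sphi).
pose D := [set x : V | (`|x| <= M + `|y|)%R].
have mD : measurable D by apply: closed_measurable_rV; exact: closed_cball.
rewrite (_ : \int[g]_x _ =
    \int[g]_(x in D) off_origin (fun u => `|phi u|) (x - y)%R).
  apply: config_integral_lty => //.
    exact: config_compact compact_cball.
  apply: (measurableT_comp moff).
  by apply: measurable_rVB; [exact: measurable_id|exact: measurable_cst].
rewrite [RHS]integral_mkcond; apply: eq_integral => x _.
rewrite patchE; case: ifPn => // /negP xD.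
rewrite /off_origin; case: ifPn => // _.
have [->|pxy] := eqVneq (phi (x - y)%R) 0; first by rewrite abse0.
exfalso; apply: xD; rewrite inE /D /=.
rewrite -[x](subrK y) (le_trans (ler_normD _ _))// lerD2r.
by apply: KM; exact: subset_closure.
Qed.

(** The integral of f is that of its positive part, which h dominates, minus
    that of its negative part, be the latter finite or not. *)
Lemma le_integral_majorant g (D : set V) (f h : V -> \bar R) : measurable D ->
  measurable_fun D f -> measurable_fun D h -> (forall x, 0 <= h x) ->
  (forall x, f x <= h x) -> \int[g]_(x in D) f x <= \int[g]_(x in D) h x.
Proof.
move=> mD mf mh h0 fh; rewrite integralE.
rewrite (@le_trans _ _ (\int[g]_(x in D) f^\+ x))//.
  by apply: geeDl; rewrite oppe_le0; exact: integral_ge0.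
apply: ge0_le_integral => //; first exact: measurable_funepos.
by move=> x _; rewrite funeposE ge_max fh h0.
Qed.

Lemma interaction_lty phi L g : measurable_fun setT phi -> measurable L ->
  interaction (fun u => `|phi u|) L g < +oo -> interaction phi L g < +oo.
Proof.
move=> mphi mL; apply: le_lt_trans.
have mabs : measurable_fun setT (fun u => `|phi u|) by exact: measurableT_comp.
have off0 (u : V) : 0 <= off_origin (fun u => `|phi u|) u.
  by rewrite /off_origin; case: ifP.
apply: le_integral_majorant => //.
- by apply: measurable_funTS; exact: measurable_interaction_inner.
- by apply: measurable_funTS; exact: measurable_interaction_inner.
- by move=> y; exact: integral_ge0.
move=> y; apply: le_integral_majorant => //.
- apply: (measurableT_comp (measurable_off_origin mphi)).
  by apply: measurable_rVB; [exact: measurable_id|exact: measurable_cst].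
- apply: (measurableT_comp (measurable_off_origin mabs)).
  by apply: measurable_rVB; [exact: measurable_id|exact: measurable_cst].
- by move=> x; rewrite /off_origin; case: ifP => // _; exact: lee_abs.
Qed.

Lemma energyE phi L g :
  interaction (fun u => `|phi u|) L g < +oo ->
  energy phi L g = interaction phi L g.
Proof.
have E psi : \int[g]_(y in L) \int[g]_x (if x != y then psi (x - y)%R else 0) =
    interaction psi L g.
  apply: eq_integral => y _; apply: eq_integral => x _; exact: off_originE.
by rewrite /energy (E (fun u => `|phi u|)) (E phi) => ->.
Qed.

(** expeR is strictly increasing and onto [0, +oo], so the preimage of a ray
    is a ray. *)
Lemma measurable_expeR : measurable_fun [set: \bar R] (@expeR R).
Proof.
apply: (measurability _ (ErealGenOInfty.measurableE R)) => _ /= -[_ [r ->] <-].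
rewrite setTI; have [r0|r0] := leP 0%R r; last first.
  rewrite (_ : _ @^-1` _ = setT)//; apply/seteqP; split => // x _ /=.
  by rewrite in_itv/= andbT (lt_le_trans _ (expeR_ge0 x)).
have [y yr] := @expeR_total R r%:E r0.
rewrite (_ : _ @^-1` _ = `]y, +oo[%classic); first exact: emeasurable_itv.
by apply/seteqP; split => x /=; rewrite !in_itv/= !andbT -yr lte_expeR.
Qed.

Lemma random_glue L : measurable L ->
  random_config (fun p : config R d * config R d => config_glue L p.1 p.2).
Proof.
move=> mL A mA; have mLC := measurableC mL.
rewrite [X in measurable_fun _ X](_ : _ = (fun p : config R d * config R d =>
    p.1 (A `&` ~` L) + p.2 (A `&` L))).
  apply: emeasurable_funD.
    by apply: (measurableT_comp (measurable_config_eval _) measurable_fst);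
      exact: measurableI.
  by apply: (measurableT_comp (measurable_config_eval _) measurable_snd);
    exact: measurableI.
by apply/funext => p; rewrite /config_glue config_addE !restrE.
Qed.

End finite_energy.

(** * Cutting a cube into small cells *)

Section grid.
Context {R : realType} {d : nat}.
Notation V := 'rV[R]_d.
Implicit Types (g : config R d) (f : V -> R) (N m : nat).

(** The cells indexed by k partition the half-open cube [-N, N[ ^ d into
    cubes of side 1/(m+1). *)
Definition cell N m (k : {ffun 'I_d -> 'I_(2 * N * m.+1)}) : set V :=
  [set v | forall i, v ord0 i \in
     `[- N%:R + (k i)%:R / m.+1%:R, - N%:R + (k i).+1%:R / m.+1%:R[].

Definition cell_corner N m (k : {ffun 'I_d -> 'I_(2 * N * m.+1)}) : V :=
  \row_i (- N%:R + (k i)%:R / m.+1%:R).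

Lemma rV_norm_le (x : V) (r : R) : 0 <= r ->
  (forall i, `|x ord0 i| <= r) -> `|x| <= r.
Proof.
move=> r0 xr; rewrite /Num.Def.normr/= mx_normrE; apply: bigmax_le => //= i _.
by rewrite ord1.
Qed.

Lemma rV_coord_le_norm (x : V) i : `|x ord0 i| <= `|x|.
Proof.
rewrite [leRHS]/Num.Def.normr/= mx_normrE.
exact: (le_bigmax _ (fun i : 'I_1 * 'I_d => `|x i.1 i.2|) (ord0, i)).
Qed.

Lemma cell_corner_in N m k : cell k (@cell_corner N m k).
Proof.
move=> i; rewrite mxE in_itv/= lexx/= ltrD2l ltr_pM2r ?invr_gt0//.
by rewrite ltr_nat.
Qed.

Lemma cell_range N m (k : 'I_(2 * N * m.+1)) :
  - N%:R + k.+1%:R / m.+1%:R <= N%:R :> R.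
Proof.
rewrite -lerBrDl opprK ler_pdivrMr// -natrD -natrM ler_nat.
by rewrite (leq_trans (ltn_ord k))// mul2n addnn.
Qed.

Lemma cell_cball N m k : @cell N m k `<=` [set x | `|x| <= N%:R].
Proof.
move=> x kx; apply: rV_norm_le => // i; have := kx i; rewrite in_itv/=.
move=> /andP[ax xb]; rewrite ler_norml; apply/andP; split.
  by apply: le_trans ax; rewrite lerDl divr_ge0.
exact: le_trans (ltW xb) (cell_range _).
Qed.

Lemma cell_diam N m k (x y : V) : @cell N m k x -> cell k y ->
  ball x m.+1%:R^-1 y.
Proof.
move=> kx ky; split; first by rewrite invr_gt0.
move=> i j; rewrite !ord1; have := kx j; have := ky j; rewrite !in_itv/=.
rewrite -[(k j).+1%:R]natr1 mulrDl div1r addrA.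
rewrite /ball/= ltr_distl.
set a := - N%:R + (k j)%:R / m.+1%:R; set e := m.+1%:R^-1.
move=> /andP[y1 y2] /andP[x1 x2].
by clearbody a e; apply/andP; split; lra.
Qed.

Lemma cell_trivIset N m : trivIset setT (@cell N m).
Proof.
apply/trivIsetP => k l _ _ /eqP kl; apply/seteqP; split => // x [kx lx].
apply: kl; apply/ffunP => i; apply/val_inj/eqP => /=; rewrite eqn_leq.
have := kx i; have := lx i; rewrite !in_itv/=.
have H (a b : nat) : - N%:R + a%:R / m.+1%:R <= x ord0 i ->
    x ord0 i < - N%:R + b.+1%:R / m.+1%:R -> (a <= b)%N.
  move=> ax xb; have := le_lt_trans ax xb.
  by rewrite ltrD2l ltr_pM2r ?invr_gt0// ltr_nat ltnS.
by move=> /andP[l1 l2] /andP[k1 k2]; rewrite (H _ _ k1 l2) (H _ _ l1 k2).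
Qed.

Lemma cell_cover N m (x : V) : `|x| < N%:R -> exists k, @cell N m k x.
Proof.
move=> xN.
pose p i := (x ord0 i + N%:R) * m.+1%:R.
have xi i : - N%:R < x ord0 i < N%:R.
  by rewrite -ltr_norml (le_lt_trans (rV_coord_le_norm _ _)).
have p0 i : 0 <= p i.
  by rewrite mulr_ge0// -lerBlDr sub0r; case/andP: (xi i) => /ltW.
have pN i : (Num.truncn (p i) < 2 * N * m.+1)%N.
  rewrite truncn_lt_nat// 2!natrM /p ltr_pM2r//.
  by case/andP: (xi i) => _; rewrite mulr_natl mulr2n ltrD2r.
exists [ffun i => Ordinal (pN i)] => i; rewrite ffunE/= in_itv/=.
have /andP[] := truncn_itv (p0 i).
rewrite -lerBrDl -ltrBlDl opprK ler_pdivrMr// ltr_pdivlMr//.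
by rewrite -/(p i) => -> ->.
Qed.

Lemma measurable_cell N m k : measurable (@cell N m k).
Proof.
have -> : cell k = \bigcap_i ((fun v : V => v ord0 i) @^-1`
    `[- N%:R + (k i)%:R / m.+1%:R, - N%:R + (k i).+1%:R / m.+1%:R[).
  by apply/seteqP; split=> [v + i _|v + i]; apply.
apply: fin_bigcap_measurable => [|i _]; first exact: finite_finset.
by rewrite -[X in measurable X]setTI; exact: measurable_coord.
Qed.

Lemma bounded_cell N m k : bounded_set (@cell N m k).
Proof. by apply: (@subset_cball_bounded _ _ _ N%:R); exact: cell_cball. Qed.

Lemma lebesgue_cell N m k :
  lebesgue_rV R d (@cell N m k) = (\prod_(i < d) m.+1%:R^-1)%:E.
Proof.
rewrite lebesgue_rV_box => [|i].
  congr EFin; apply: eq_bigr => i _.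
  by rewrite addrAC opprD addrA subrr add0r addrC -mulrBl -natrB// subSnn div1r.
by rewrite lerD2l ler_pM2r ?invr_gt0// ler_nat.
Qed.

End grid.

(** * Counting points in cells *)

Section vague_counting.
Context {R : realType} {d : nat}.
Notation V := 'rV[R]_d.
Implicit Types (g : config R d) (f : V -> R).

(** By compactness of the ball one scale 1/(m+1) serves all its points. *)
Lemma near_uniform_modulus f (M e : R) : continuous f -> 0 < e ->
  \forall m \near \oo, forall x y : V, `|x| <= M ->
    ball x m.+1%:R^-1 y -> `|f x - f y| <= e.
Proof.
move=> cf e0.
pose P m (x : V) := forall y, ball x m.+1%:R^-1 y -> `|f x - f y| <= e.
suff : \forall m \near \oo, [set x : V | `|x| <= M] `<=` P m.
  by apply: filterS => m KP x y /KP; exact.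
have /compact_near_coveringP := @compact_cball R d M; apply => x _.
have : nbhs x (f @^-1` ball (f x) (e / 2)).
  by apply: cf; apply: nbhsx_ballx; rewrite divr_gt0.
move=> /nbhs_ballP[r /= r0 fr].
exists (ball x (r / 2), [set m | m.+1%:R^-1 < r / 2]) => /=.
  split; first by apply: nbhsx_ballx; rewrite divr_gt0.
  near=> m => /=; rewrite invf_plt ?posrE ?divr_gt0//.
  rewrite (@le_lt_trans _ _ m%:R) ?ltr_nat//.
  by near: m; exact: nbhs_infty_ger.
move=> [x' m] /= [xx' mr] y x'y.
have fxx' : ball (f x) (e / 2) (f x').
  by apply: fr; apply: le_ball xx'; rewrite ler_pdivrMr// ler_pMr// ler1n.
have fxy : ball (f x) (e / 2) (f y).
  apply: fr; rewrite (splitr r); apply: ball_triangle xx' _.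
  by apply: le_ball x'y; exact: ltW.
move: fxx' fxy; rewrite /ball/= => h1 h2.
rewrite (splitr e) (le_trans (ler_distD (f x) _ _))// ltW// ltrD//.
by rewrite distrC.
Unshelve. all: by end_near. Qed.

(** The Riemann sum depends on g only through the numbers of points in the
    pieces; this is how such numbers control integrals. *)
Lemma riemann_sum_config (I : finType) (C : I -> set V) (c : I -> V) f
    (e : R) g :
  (forall i, measurable (C i)) -> (forall i, bounded_set (C i)) ->
  trivIset setT C -> continuous f -> compactly_supported f ->
  (forall x, f x != 0 -> exists i, C i x) ->
  (forall i x, C i x -> `|f (c i) - f x| <= e) ->
  `|\int[g]_x f x - \sum_i f (c i) * fine (g (C i))| <=
    e * \sum_i fine (g (C i)).
Proof.
move=> mC bC tC cf sf fC fe.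
have fg := Cc_integrable g cf sf.
have -> : \int[g]_x f x = \sum_i \int[g]_(x in C i) f x.
  pose D := \big[setU/set0]_(i <- index_enum I) C i.
  have mf : measurable_fun setT (EFin \o f) by case/integrableP : fg.
  have -> : \int[g]_x f x = fine (\int[g]_(x in D) (f x)%:E)%E.
    rewrite /Rintegral; congr fine; rewrite [RHS]integral_mkcond.
    apply: eq_integral => x _; rewrite patchE; case: ifPn => // /negP xD.
    have [->//|/fC[i Cx]] := eqVneq (f x) 0.
    exfalso; apply: xD; rewrite inE /D -bigcup_seq; exists i => //=.
    by rewrite mem_index_enum.
  rewrite integral_bigsetU_EFin//.
  - rewrite -sum_fine// => i _; apply: integrable_fin_num => //.
    exact: integrableS fg.
  - exact: index_enum_uniq.
  - exact: sub_trivIset tC.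
  - exact: measurable_funTS.
rewrite -sumrB mulr_sumr (le_trans (ler_norm_sum _ _ _))//.
apply: ler_sum => i _.
have gC : (g (C i) < +oo)%E by exact: config_bounded_fin.
have fCi : g.-integrable (C i) (EFin \o f) by exact: integrableS fg.
have cCi (r : R) : g.-integrable (C i) (EFin \o cst r).
  apply/integrableP; split; first exact/measurable_EFinP.
  by rewrite [ltLHS](integral_cst g (mC i) `|r|%:E) lte_mul_pinfty// ltry.
have lo : (f (c i) - e) * fine (g (C i)) <= \int[g]_(x in C i) f x.
  rewrite -(Rintegral_cst g (mC i)).
  apply: (le_Rintegral (mC i) (cCi (f (c i) - e)) fCi) => x /fe.
  by rewrite ler_distlC => /andP[].
have hi : \int[g]_(x in C i) f x <= (f (c i) + e) * fine (g (C i)).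
  rewrite -(Rintegral_cst g (mC i)).
  apply: (le_Rintegral (mC i) fCi (cCi (f (c i) + e))) => x /fe.
  by rewrite ler_distlC => /andP[].
by rewrite ler_distl -mulrBl -mulrDl lo hi.
Qed.

(** A bound that does not depend on the mesh m, as needed to make the
    Riemann sum error small. *)
Lemma sum_cell_le g N m : \sum_k fine (g (@cell R d N m k)) <=
  fine (g [set x | `|x| <= N%:R]).
Proof.
have mB : measurable [set x : V | `|x| <= N%:R].
  by apply: closed_measurable_rV; exact: closed_cball.
have mC (k : {ffun 'I_d -> 'I_(2 * N * m.+1)}) : measurable (cell k : set V).
  exact: measurable_cell.
have gC k : g (@cell R d N m k) \is a fin_num.
  rewrite ge0_fin_numE//; apply: config_bounded_fin;
    first exact: measurable_cell.
  exact: bounded_cell.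
rewrite sum_fine//; apply: fine_le.
- by apply/sum_fin_numP.
- by rewrite ge0_fin_numE// config_compact//; exact: compact_cball.
pose D := \big[setU/set0]_(k <- index_enum _) @cell R d N m k.
have mD : measurable D by exact: bigsetU_measurable.
have := @ge0_integral_bigsetU _ _ _ g _ (@cell R d N m) (cst 1%E)
  (index_enum _) mC (index_enum_uniq _).
rewrite /= integral_cst// mul1e => DE.
have DB : (g D <= g [set x : V | (`|x| <= N%:R)%R])%E.
  apply: le_measure; rewrite ?inE// => x.
  by rewrite /D -bigcup_seq => -[k _]; exact: cell_cball.
apply: le_trans DB; rewrite DE//;
  last exact: sub_trivIset (@cell_trivIset R d N m).
rewrite le_eqVlt; apply/orP; left; apply/eqP/eq_bigr => k _.
by rewrite (integral_cst g (mC k) 1%E) mul1e.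
Qed.

(** Two configurations with equal cell counts have the same Riemann sum, and
    the error of the Riemann sum is small uniformly over such configurations. *)
Lemma near_cell_counts_integral f g0 N (O : set R) :
  continuous f -> compactly_supported f ->
  (forall x, f x != 0 -> `|x| < N%:R) ->
  open O -> O (\int[g0]_x f x) ->
  \forall m \near \oo, forall g,
    (forall k, g (@cell R d N m k) = g0 (cell k)) -> O (\int[g]_x f x).
Proof.
move=> cf sf fN oO Of.
have /nbhs_ballP[e /= e0 eO] : nbhs (\int[g0]_x f x) O by exact: open_nbhs_nbhs.
pose S := fine (g0 [set x | `|x| <= N%:R]).
have S1 : 0 < S + 1 by rewrite ltr_wpDl// fine_ge0.
(* Both integrals are within eta * S < e / 2 of the common Riemann sum; the
   1 covers the case S = 0. *)
pose eta := e / 2 / (S + 1).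
have eta0 : 0 < eta by rewrite !divr_gt0.
have := near_uniform_modulus N%:R cf eta0; apply: filterS => m fm g gg0.
apply: eO; rewrite -ball_normE /=.
pose A := \sum_k f (cell_corner k) * fine (g0 (@cell R d N m k)).
have H (h : config R d) : (forall k, h (@cell R d N m k) = g0 (cell k)) ->
    `|\int[h]_x f x - A| < e / 2.
  move=> hg0.
  have -> : A = \sum_k f (cell_corner k) * fine (h (@cell R d N m k)).
    by apply: eq_bigr => k _; rewrite hg0.
  apply: (@le_lt_trans _ _ (eta * \sum_k fine (h (@cell R d N m k)))).
    apply: (@riemann_sum_config _ (@cell R d N m) (@cell_corner R d N m)).
    - exact: measurable_cell.
    - exact: bounded_cell.
    - exact: cell_trivIset.
    - exact: cf.
    - exact: sf.
    - by move=> x /fN; exact: cell_cover.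
    - move=> k x kx; have ck := @cell_corner_in R d N m k.
      by apply: fm; [exact: cell_cball ck|exact: cell_diam ck kx].
  have -> : \sum_k fine (h (@cell R d N m k)) =
      \sum_k fine (g0 (@cell R d N m k)).
    by apply: eq_bigr => k _; rewrite hg0.
  rewrite (@le_lt_trans _ _ (eta * S))// ?ler_pM2l ?sum_cell_le//.
  by rewrite -ltr_pdivlMl// /eta invf_div divfK ?lt0r_neq0// ?divr_gt0// ltrDl.
rewrite (splitr e) (le_lt_trans (ler_distD A _ _))// ltrD ?H//.
by rewrite distrC H.
Qed.

(** The probability is a finite product of Poisson weights, which are positive
    at a positive rate. *)
Lemma poisson_counts_gt0 (nu : set V -> \bar R) (P : probability (config R d) R)
    (I : finType) (C : I -> set V) (n : I -> nat) :
  poisson_measure nu P ->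
  (forall i, measurable (C i)) -> (forall i, bounded_set (C i)) ->
  trivIset setT C -> (forall i, 0 < fine (nu (C i))) ->
  (0 < P [set g : config R d | forall i, g (C i) = (n i)%:R%:E])%E.
Proof.
move=> PP mC bC tC nuC; pose e (j : 'I_#|I|) : I := enum_val j.
have E : [set g : config R d | forall i, g (C i) = (n i)%:R%:E] =
    [set g : config R d | forall j, g (C (e j)) = (n (e j))%:R%:E].
  apply/seteqP; split=> g gE; first by move=> j; exact: gE.
  by move=> i; rewrite -[i]enum_rankK; exact: gE.
rewrite E (PP _ (C \o e) (n \o e)).
- rewrite lte_fin; apply: prodr_gt0 => j _; rewrite /poisson_weight.
  by rewrite mulr_gt0 ?expR_gt0// divr_gt0 ?exprn_gt0 ?nuC// ltr0n fact_gt0.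
- by move=> j; exact: mC.
- by move=> j; exact: bC.
- apply/trivIsetP => i j _ _ ij; move/trivIsetP : tC; apply => //.
  by apply: contra_neq ij; exact: enum_val_inj.
Qed.

Lemma measurable_cell_counts N m (n : {ffun 'I_d -> 'I_(2 * N * m.+1)} -> nat) :
  measurable [set g : config R d | forall k, g (cell k) = (n k)%:R%:E].
Proof.
have -> : [set g : config R d | forall k, g (cell k) = (n k)%:R%:E] =
    \bigcap_k [set g : config R d | g (cell k) = (n k)%:R%:E].
  by apply/seteqP; split => [g + k _|g + k]; apply.
apply: fin_bigcap_measurable => [|k _]; first exact: finite_finset.
have := measurable_config_eval (@measurable_cell R d N m k) measurableT.
move=> /(_ [set (n k)%:R%:E] (emeasurable_set1 _)).
by rewrite setTI.
Qed.

End vague_counting.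

(** * Positivity of integrals, and the Gibbs kernel *)

Section integrals.
Local Open Scope ereal_scope.
Context {dT : measure_display} {T : measurableType dT} {R : realType}.

Lemma integral_eq0_ae (mu : {measure set T -> \bar R}) (h : T -> \bar R) :
  measurable_fun setT h -> (forall t, 0 <= h t) ->
  \int[mu]_t h t = 0 <-> {ae mu, forall t, h t = 0}.
Proof.
move=> mh h0; have -> : \int[mu]_t h t = \int[mu]_t `|h t|.
  by apply: eq_integral => t _; rewrite gee0_abs.
split=> [/(ae_eq_integral_abs mu measurableT mh)|H].
  by apply: filterS => t /(_ I).
by apply/(ae_eq_integral_abs mu measurableT mh); apply: filterS H => t ht _.
Qed.

Lemma integral_gt0 (mu : {measure set T -> \bar R}) (h : T -> \bar R)
    (S : set T) :
  measurable_fun setT h -> (forall t, 0 <= h t) -> measurable S -> 0 < mu S ->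
  (forall t, S t -> 0 < h t) -> 0 < \int[mu]_t h t.
Proof.
move=> mh h0 mS muS hS; rewrite lt_neqAle integral_ge0// andbT eq_sym.
apply/negP => /eqP/(integral_eq0_ae mu mh h0) [N [mN N0 hN]].
suff : mu S = 0 by move=> S0; rewrite S0 ltxx in muS.
apply/eqP; rewrite eq_le measure_ge0 andbT -N0; apply: le_measure;
  rewrite ?inE//.
by move=> t /hS ht; apply: hN => /= ht0; rewrite ht0 ltxx in ht.
Qed.

(** Inversion reverses the order of nonnegative extended reals, with
    0^-1 = +oo. *)
Lemma measurable_inve (f : T -> \bar R) : measurable_fun setT f ->
  (forall t, 0 <= f t) -> measurable_fun setT (fun t => (f t)^-1).
Proof.
move=> mf f0.
apply: (measurability _ (ErealGenOInfty.measurableE R)) => _ /= -[_ [r ->] <-].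
rewrite setTI; have [r0|r0] := leP 0%R r; last first.
  rewrite (_ : _ @^-1` _ = setT)//; apply/seteqP; split => // t _ /=.
  by rewrite in_itv/= andbT (@lt_le_trans _ _ 0)// inve_ge0.
rewrite (_ : _ @^-1` _ = setT `&` [set t | f t < r%:E^-1]).
  exact: emeasurable_fun_infty_o.
apply/seteqP; split=> t /=; rewrite in_itv/= andbT.
  by move=> rf; split=> //; rewrite -inve_pgt// ?inE.
by move=> [_]; rewrite inve_pgt// ?inE.
Qed.

End integrals.

Section gibbs.
Context {R : realType} {d : nat}.
Notation V := 'rV[R]_d.
Implicit Types (phi : V -> \bar R) (L : set V) (P : probability (config R d) R).
Local Open Scope ereal_scope.

(** The test Z < +oo in the kernel is absorbed by the convention +oo^-1 = 0. *)
Lemma gibbs_kernelE P phi L g B : gibbs_kernel P phi L g B =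
  (partition_function P phi L g)^-1 *
  \int[P]_w ((\1_B (config_glue L g w))%:E *
             expeR (- energy phi L (config_glue L g w))).
Proof.
rewrite /gibbs_kernel; case: ifPn => //; rewrite -leNgt leye_eq => /eqP ->.
by rewrite invey mul0e.
Qed.

Definition vague_box n (F : 'I_n -> V -> R) (O : 'I_n -> set R) :
    set (config R d) :=
  [set g | forall i, O i (\int[g]_x F i x)%R].

Lemma measurable_vague_box dT (T : measurableType dT) (K : T -> config R d) n
    (F : 'I_n -> V -> R) (O : 'I_n -> set R) : random_config K ->
  (forall i, continuous (F i)) -> (forall i, open (O i)) ->
  measurable (K @^-1` vague_box F O).
Proof.
move=> mK cF oO.
have -> : K @^-1` vague_box F O =
    \bigcap_i ((fun t => (\int[K t]_x F i x)%R) @^-1` O i).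
  by apply/seteqP; split => [t + i _|t + i]; apply.
apply: fin_bigcap_measurable => [|i _]; first exact: finite_finset.
rewrite -[X in measurable X]setTI.
have mI : measurable_fun setT (fun t => (\int[K t]_x F i x)%R).
  apply: (@measurableT_comp _ _ _ _ _ _ fine) => //.
  apply: (measurable_integral_config (F := fun p : T * V => (F i p.2)%:E)) => //.
  apply/measurable_EFinP; apply: (measurableT_comp _ measurable_snd).
  exact: measurable_continuous_rV.
by apply: mI => //; exact: open_measurable.
Qed.

End gibbs.

(** * Full support *)

Theorem corollary2p2 (R : realType) (d : nat) (phi : 'rV[R]_d -> \bar R)
  (z : R) (pi_zm mu : probability (config R d) R) :
  (0 < d)%N ->
  pair_potential phi ->
  superstable phi ->
  lower_regular phi ->
  compact_support phi ->
  condition_I phi ->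
  condition_D phi ->
  bounded_off_origin phi ->
  0 < z ->
  poisson_measure (fun A => (z%:E * lebesgue_rV R d A)%E) pi_zm ->
  gibbs_measure pi_zm phi mu ->
  tempered mu ->
  full_topological_support mu.
Proof.
move=> _ [mphi _ _] _ _ sphi _ _ bphi z0 PP gibbs _ U oU [g0 Ug0].
have phioo := bounded_off_origin_lty bphi.
have [n [F [Q]]] := vague_nbhs oU Ug0; move=> [FQ Qg0 FQU].
have cF i : continuous (F i) by case: (FQ i).
have sF i : compactly_supported (F i) by case: (FQ i).
have oQ i : open (Q i) by case: (FQ i).
pose B := vague_box F Q.
have mB : measurable B.
  by apply: (measurable_vague_box (K := id)) => // A;
    exact: measurable_config_eval.
(* From here on U is replaced by the basic neighbourhood B of g0. *)
suff muB : (0 < mu B)%E.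
  rewrite (lt_le_trans muB)//; apply: le_measure; rewrite ?inE//.
  exact: (@sub_sigma_algebra _ setT (@open (config R d))).
have [N FN] : exists N : nat, forall i x, F i x != 0 -> `|x| < N%:R.
  suff : \forall N \near \oo, forall i x, F i x != 0 -> `|x| < N%:R.
    by move=> [N _ NF]; exists N; exact: (NF N (leqnn N)).
  apply: filter_forall => i.
  have [M FM] := bounded_subset_cball (compact_bounded (sF i)).
  near=> N => x Fx; apply: (@le_lt_trans _ _ M).
    by apply: FM; exact: subset_closure.
  by near: N; exact: nbhs_infty_gtr.
have [m Fm] : exists m, forall i (g : config R d),
    (forall k, g (@cell R d N m k) = g0 (cell k)) -> Q i (\int[g]_x F i x).
  suff : \forall m \near \oo, forall i (g : config R d),
      (forall k, g (@cell R d N m k) = g0 (cell k)) -> Q i (\int[g]_x F i x).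
    by move=> [m _ mF]; exists m; exact: (mF m (leqnn m)).
  apply: filter_forall => i; apply: near_cell_counts_integral => //.
  exact: FN.
have mC := @measurable_cell R d N m.
have /choice[c g0c] : forall k, exists j : nat, g0 (@cell R d N m k) = j%:R%:E.
  move=> k; have [g0oo|] := config_integer g0 (mC k); last by [].
  by have := config_bounded_fin g0 (mC k) (@bounded_cell R d N m k);
    rewrite g0oo ltxx.
pose S := [set w : config R d | forall k, w (@cell R d N m k) = (c k)%:R%:E].
have mS : measurable S by exact: measurable_cell_counts.
have PS : (0 < pi_zm S)%E.
  apply: poisson_counts_gt0 PP _ _ _ _ => [k|k||k].
  - exact: mC.
  - exact: bounded_cell.
  - exact: cell_trivIset.
  - by rewrite lebesgue_cell /= mulr_gt0// prodr_gt0.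
(* L is open and contains the closure of the cells, so that gluing leaves the
   numbers of points in the cells unchanged. *)
pose L := ball (0 : 'rV[R]_d) N.+1%:R.
have oL : open L by exact: ball_open.
have mL : measurable L by exact: measurable_ball_rV.
have bL : bounded_set L by exact: bounded_ball.
have L0 : L !=set0 by exists 0; exact: ballxx.
have SB g w : S w -> B (config_glue L g w).
  move=> Sw i; apply: Fm => k; rewrite g0c -(Sw k) /config_glue config_addE.
  have kL : @cell R d N m k `<=` L.
    move=> x /cell_cball xN; rewrite /L -ball_normE /= sub0r normrN.
    by rewrite (le_lt_trans xN)// ltr_nat.
  rewrite !restrE//; last exact: measurableC.
  rewrite (_ : _ `&` ~` L = set0) ?measure0 ?add0e; last first.
    by apply/seteqP; split => // x [/kL].
  by congr (w _); exact/setIidPl.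
have energy_lty h : (energy phi L h < +oo)%E.
  have habs := interaction_abs_lty h mphi sphi phioo mL bL.
  by rewrite (energyE habs); exact: interaction_lty mphi mL habs.
pose W (p : config R d * config R d) :=
  expeR (- energy phi L (config_glue L p.1 p.2)).
have W0 p : (0 < W p)%E by rewrite expeR_gt0// lteNr/= energy_lty.
have mK := @random_glue R d L mL.
have mW : measurable_fun setT W.
  rewrite /W; apply: (measurableT_comp (@measurable_expeR R)).
  apply: measurableT_comp => //.
  rewrite [X in measurable_fun _ X](_ : _ =
      (fun p => interaction phi L (config_glue L p.1 p.2))).
    exact: measurable_interaction.
  apply/funext => p; apply: energyE.
  exact: interaction_abs_lty mphi sphi phioo mL bL.
pose ind (D : set (config R d)) (p : config R d * config R d) :=
  ((\1_D (config_glue L p.1 p.2))%:E * W p)%E.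
have ind0 D p : (0 <= ind D p)%E by rewrite mule_ge0 ?lee_fin// ltW.
have mind D : measurable ((fun p => config_glue L p.1 p.2) @^-1` D) ->
    measurable_fun setT (ind D).
  move=> mD; apply: emeasurable_funM => //; apply/measurable_EFinP.
  exact: (measurable_indic mD).
pose Z g : \bar R := (\int[pi_zm]_w W (g, w))%E.
pose G D g : \bar R := (\int[pi_zm]_w ind D (g, w))%E.
have mZ : measurable_fun setT Z.
  apply: (@measurable_fun_fubini_tonelli_F _ _ _ _ _ pi_zm) => // p.
  exact: ltW.
have mG D : measurable ((fun p => config_glue L p.1 p.2) @^-1` D) ->
    measurable_fun setT (G D).
  move=> mD; apply: (@measurable_fun_fubini_tonelli_F _ _ _ _ _ pi_zm) => //.
  exact: mind.
have Z0 g : (0 <= Z g)%E by apply: integral_ge0 => w _; exact: ltW.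
have G0 D g : (0 <= G D g)%E by apply: integral_ge0 => w _; exact: ind0.
have kernelE D g : gibbs_kernel pi_zm phi L g D = ((Z g)^-1 * G D g)%E.
  exact: gibbs_kernelE.
have muE D : measurable D -> mu D = (\int[mu]_g ((Z g)^-1 * G D g))%E.
  move=> mD; rewrite -(gibbs L oL bL L0 D mD).
  by apply: eq_integral => g _; rewrite kernelE.
have mglueB : measurable ((fun p => config_glue L p.1 p.2) @^-1` B).
  exact: measurable_vague_box.
have mkernel D : measurable ((fun p => config_glue L p.1 p.2) @^-1` D) ->
    measurable_fun setT (fun g => (Z g)^-1 * G D g)%E.
  by move=> mD; apply: emeasurable_funM; [exact: measurable_inve|exact: mG].
have kernel0 D g : (0 <= (Z g)^-1 * G D g)%E by rewrite mule_ge0 ?inve_ge0.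
have GB0 g : (0 < G B g)%E.
  apply: (integral_gt0 (S := S)) => //.
  - by apply: (measurableT_comp (mind _ mglueB)); exact: measurable_pair1.
  - by move=> w Sw; rewrite /ind indicE mem_set ?mul1e//; exact: SB.
rewrite lt_neqAle measure_ge0 andbT eq_sym muE//; apply/negP => /eqP.
(* If mu B = 0 then, G B being positive, Z is almost surely infinite, and so
   the kernel vanishes on every event, even on the whole space. *)
move=> /(integral_eq0_ae mu (mkernel _ mglueB) (kernel0 B)) ZGB0.
have : mu setT = 0.
  rewrite muE//; apply/(integral_eq0_ae mu _ (kernel0 setT)).
    by apply: mkernel; rewrite preimage_setT.
  apply: filterS ZGB0 => g /eqP; rewrite mule_eq0 (gt_eqF (GB0 g)) orbF.
  by move=> /eqP ->; rewrite mul0e.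
by rewrite probability_setT => /eqP; rewrite onee_eq0.
Unshelve. all: end_near. Qed.
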